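(* Let $a,b\in I$ with $a<s_0<b$. Let $f:[a,b]\to\mathbb{R}$ be an absolutely $\beta$-integrable function on $[a,b]$, and suppose that there exist real numbers $m$ and $M$ such that $m\le f(x)\le M$ for all $x\in[a,b]_\beta$. If $u:[a,b]\to\mathbb{R}$ is $\beta$-$L$-Lipschitzian on $[a,b]$ and $\lim_{n\to\infty}u(\beta^n(x))$ exists for $x=a$ and for $x=b$, then $$\left|\int_a^b f(x)\,d_\beta u(x)-\frac{u(b)-u(a)-\left(u(s_0^+)-u(s_0^-)\right)}{b-a}\int_a^b f(t)\,d_\beta t\right|\le\frac12 L(M-m)(b-a).$$ The constant $\frac12$ is the best possible: there is no constant $c<\frac12$ such that the inequality with $\frac12$ replaced by $c$ holds for all admissible data $(I,\beta,a,b,f,u,m,M,L)$.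
   Context: Setting: $I\subseteq\mathbb{R}$ is an interval and $\beta:I\to I$ is a strictly increasing continuous function with exactly one fixed point $s_0\in I$, satisfying $(t-s_0)(\beta(t)-t)\le 0$ for all $t\in I$, with equality only if $t=s_0$. Write $\beta^0(t)=t$ and $\beta^k$ for the $k$-fold composition of $\beta$ with itself. For $a,b\in I$, $[a,b]_\beta:=\{\beta^k(a):k\ge 0\}\cup\{\beta^k(b):k\ge 0\}\cup\{s_0\}$. The $\beta$-integral is $\int_a^b h\,d_\beta:=\int_{s_0}^b h\,d_\beta-\int_{s_0}^a h\,d_\beta$, where $\int_{s_0}^x h\,d_\beta:=\sum_{k=0}^{\infty}\big(\beta^k(x)-\beta^{k+1}(x)\big)h\big(\beta^k(x)\big)$; also written $\int_a^b h(x)\,d_\beta x$. The function $h$ is $\beta$-integrable on $[a,b]$ if these series converge for $x=a$ and $x=b$, and absolutely $\beta$-integrable on $[a,b]$ if $|h|$ is $\beta$-integrable on $[a,b]$. Riemann–Stieltjes $\beta$-integral: for a real function $u$ of bounded variation on $[a,b]_\beta$, $$\int_a^b f(x)\,d_\beta u(x):=\sum_{k=0}^\infty f(\beta^k(b))\big(u(\beta^k(b))-u(\beta^{k+1}(b))\big)-\sum_{k=0}^\infty f(\beta^k(a))\big(u(\beta^k(a))-u(\beta^{k+1}(a))\big).$$ A real function $u$ is $\beta$-$L$-Lipschitzian on $[a,b]$ if $|u(x)-u(\beta(x))|\le L|x-\beta(x)|$ for all $x\in[a,b]_\beta$. (Such a function is automatically of bounded variation on $[a,b]_\beta$.) Notation: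 $u(s_0^+):=\lim_{n\to\infty}u(\beta^n(b))$ and $u(s_0^-):=\lim_{n\to\infty}u(\beta^n(a))$. *)

(* Defs.v *)
From HB Require Import structures.
From mathcomp Require Import all_boot all_order all_algebra.
From mathcomp Require Import all_classical all_reals all_analysis.
Set Implicit Arguments.
Unset Strict Implicit.
Unset Printing Implicit Defensive.
Import Order.TTheory GRing.Theory Num.Theory.
Import numFieldNormedType.Exports.
Local Open Scope classical_set_scope.
Local Open Scope ring_scope.

(* Functions defined on I, or on [a, b], are represented by total functions
   R -> R; their values outside of that domain are never used. *)

Record beta_system (R : realType) (I : set R) (beta : R -> R) (s0 : R) : Prop :=
  BetaSystem {
    bs_interval : is_interval I ;
    bs_stable : forall t, I t -> I (beta t) ;
    bs_increasing : forall x y, I x -> I y -> x < y -> beta x < beta y ;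
    bs_continuous : {within I, continuous beta} ;
    bs_mem : I s0 ;
    bs_fixed : beta s0 = s0 ;
    bs_unique : forall t, I t -> beta t = t -> t = s0 ;
    bs_sign : forall t, I t -> (t - s0) * (beta t - t) <= 0 ;
    bs_sign_eq : forall t, I t -> (t - s0) * (beta t - t) = 0 -> t = s0
  }.

Definition beta_interval (R : realType) (beta : R -> R) (s0 a b : R) : set R :=
  range (fun k => iter k beta a) `|` range (fun k => iter k beta b) `|` [set s0].

Definition beta_term (R : realType) (beta h : R -> R) (x : R) : R^nat :=
  fun k => (iter k beta x - iter k.+1 beta x) * h (iter k beta x).

(* [limn] is only meaningful for a convergent sequence, hence the separate
   predicates [beta_integrable] and [beta_RS_integrable]. *)
Definition beta_integrable (R : realType) (beta h : R -> R) (a b : R) : Prop :=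
  cvgn (series (beta_term beta h a)) /\ cvgn (series (beta_term beta h b)).

Definition abs_beta_integrable (R : realType) (beta h : R -> R) (a b : R)
    : Prop :=
  beta_integrable beta (fun x => `|h x|) a b.

Definition beta_integral (R : realType) (beta h : R -> R) (a b : R) : R :=
  limn (series (beta_term beta h b)) - limn (series (beta_term beta h a)).

Definition beta_RS_term (R : realType) (beta f u : R -> R) (x : R) : R^nat :=
  fun k => f (iter k beta x) * (u (iter k beta x) - u (iter k.+1 beta x)).

Definition beta_RS_integrable (R : realType) (beta f u : R -> R) (a b : R)
    : Prop :=
  cvgn (series (beta_RS_term beta f u a)) /\
  cvgn (series (beta_RS_term beta f u b)).

Definition beta_RS_integral (R : realType) (beta f u : R -> R) (a b : R) : R :=
  limn (series (beta_RS_term beta f u b)) -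
  limn (series (beta_RS_term beta f u a)).

Definition beta_Lipschitz (R : realType) (beta : R -> R) (s0 a b L : R)
    (u : R -> R) : Prop :=
  forall x, beta_interval beta s0 a b x ->
    `|u x - u (beta x)| <= L * `|x - beta x|.

(* u(s0^+) is [orbit_lim beta u b] and u(s0^-) is [orbit_lim beta u a]. *)
Definition orbit_lim (R : realType) (beta u : R -> R) (x : R) : R :=
  limn (fun n => u (iter n beta x)).

Record admissible (R : realType) (I : set R) (beta : R -> R) (s0 a b : R)
    (f u : R -> R) (m M L : R) : Prop :=
  Admissible {
    adm_system : beta_system I beta s0 ;
    adm_a : I a ;
    adm_b : I b ;
    adm_as0 : a < s0 ;
    adm_s0b : s0 < b ;
    adm_f : abs_beta_integrable beta f a b ;
    adm_bounds : forall x, beta_interval beta s0 a b x -> m <= f x <= M ;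
    adm_u : beta_Lipschitz beta s0 a b L u ;
    adm_lim_a : cvgn (fun n => u (iter n beta a)) ;
    adm_lim_b : cvgn (fun n => u (iter n beta b))
  }.

(* Main.v *)
Require Import Defs.
From HB Require Import structures.
From mathcomp Require Import all_boot all_order all_algebra.
From mathcomp Require Import all_classical all_reals all_analysis.
From mathcomp Require Import ring lra.
Set Implicit Arguments.
Unset Strict Implicit.
Unset Printing Implicit Defensive.
Import Order.TTheory GRing.Theory Num.Theory.
Import numFieldNormedType.Exports.
Local Open Scope classical_set_scope.
Local Open Scope ring_scope.

(* The orbits of a and b converge monotonically to s0, so the beta-integral is
   integration against a positive discrete measure of total mass b - a. With mu
   the mean of f, the quantity to bound is the integral of f - mu against
   d_beta u, hence at most L times the integral of |f - mu|. By convexity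
   |f - mu| lies below the affine function of f that agrees with it at m and M;
   integrating gives 2 (M - mu) (mu - m) (b - a) / (M - m), which is at most
   (M - m) (b - a) / 2. *)

(** * Limits and comparison of series *)

Lemma cvg_series_diff (R : realType) (y : R^nat) (l : R) :
  y @ \oo --> l -> series (fun k => y k - y k.+1) @ \oo --> y 0%N - l.
Proof.
move=> yl.
rewrite (_ : series _ = (fun n => y 0%N - y n)); first by apply: cvgB => //; exact: cvg_cst.
apply/funext => n; rewrite /series /=.
elim: n => [|n IH]; first by rewrite big_geq// subrr.
by rewrite big_nat_recr//= IH addrA subrK.
Qed.

Lemma cvg_series_scale (R : realType) (c : R) (v : R^nat) (l : R) :
  series v @ \oo --> l -> series (fun k => c * v k) @ \oo --> c * l.
Proof.
move=> vl; rewrite (_ : series _ = (fun n => c * series v n)); first exact: cvgMr.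
by apply/funext => n; rewrite /series /= mulr_sumr.
Qed.

Lemma cvg_series_add (R : realType) (v w : R^nat) (l l' : R) :
  series v @ \oo --> l -> series w @ \oo --> l' ->
  series (fun k => v k + w k) @ \oo --> l + l'.
Proof.
move=> vl wl; rewrite (_ : series _ = (fun n => series v n + series w n)).
  exact: cvgD.
by apply/funext => n; rewrite /series /= big_split.
Qed.

Lemma ler_cvg_series (R : realType) (v w : R^nat) (l l' : R) :
  (forall k, v k <= w k) ->
  series v @ \oo --> l -> series w @ \oo --> l' -> l <= l'.
Proof.
move=> vw vl wl; apply: (ler_cvg_to vl wl); apply: nearW => n.
by apply: ler_sum => k _.
Qed.

Lemma ler_norm_cvg_series (R : realType) (v w : R^nat) (l l' : R) :
  (forall k, `|v k| <= w k) ->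
  series v @ \oo --> l -> series w @ \oo --> l' -> `|l| <= l'.
Proof.
move=> vw vl wl; rewrite ler_norml; apply/andP; split; last first.
  by apply: (ler_cvg_series _ vl wl) => k; exact: le_trans (ler_norm _) (vw k).
rewrite -mulN1r; apply: (ler_cvg_series _ (cvg_series_scale (c := -1) wl) vl) => k.
by rewrite mulN1r lerNl; apply: le_trans (vw k); rewrite -normrN ler_norm.
Qed.

Lemma cvg_series_dominated (R : realType) (v w : R^nat) :
  (forall k, `|v k| <= w k) -> cvgn (series w) -> cvgn (series v).
Proof.
move=> vw cw; apply: normed_cvg.
by apply: (series_le_cvg _ _ vw cw) => // n; exact: le_trans (vw n).
Qed.

(** * Orbits of [beta] and their convergence to [s0] *)

(** Monotonicity keeps [beta t] on its side of the fixed point, and the strict sign condition moves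
    it closer. The factor [e] has the sign of [t - s0] and treats both sides at once: later [e = -1]
    at [a] and [e = 1] at [b]. *)
Lemma beta_step (R : realType) (I : set R) (beta : R -> R) (s0 e t : R) :
  beta_system I beta s0 -> I t -> 0 < e * (t - s0) ->
  0 < e * (beta t - s0) < e * (t - s0).
Proof.
move=> sys It et.
have ts0 : t != s0.
  by apply: contraTneq et => ->; rewrite subrr mulr0 ltxx.
have sgn : (t - s0) * (beta t - t) < 0.
  rewrite lt_neqAle (bs_sign sys It) andbT.
  by apply: contraNneq ts0 => /(bs_sign_eq sys It) ->.
have inc := bs_increasing sys; have fix0 := bs_fixed sys; have Is0 := bs_mem sys.
case: (ltgtP t s0) ts0 => // lt_t _.
- have := inc _ _ It Is0 lt_t; rewrite fix0 => bt.
  have e0 : e < 0 by rewrite -(@nmulr_lgt0 _ (t - s0)) ?subr_lt0.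
  have tb : t < beta t by move: sgn; rewrite nmulr_rlt0 ?subr_lt0// subr_gt0.
  by rewrite nmulr_rgt0// subr_lt0 bt ltr_nM2l// ltrD2r.
- have := inc _ _ Is0 It lt_t; rewrite fix0 => bt.
  have e0 : 0 < e by rewrite -(@pmulr_lgt0 _ (t - s0)) ?subr_gt0.
  have tb : beta t < t by move: sgn; rewrite pmulr_rlt0 ?subr_gt0// subr_lt0.
  by rewrite pmulr_rgt0// subr_gt0 bt ltr_pM2l// ltrD2r.
Qed.

Lemma orbit_mem (R : realType) (I : set R) (beta : R -> R) (s0 x : R) (k : nat) :
  beta_system I beta s0 -> I x -> I (iter k beta x).
Proof. by move=> sys Ix; elim: k => //= k; exact: (bs_stable sys). Qed.

Lemma orbit_side (R : realType) (I : set R) (beta : R -> R) (s0 e x : R) (k : nat) :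
  beta_system I beta s0 -> I x -> 0 < e * (x - s0) ->
  0 < e * (iter k beta x - s0).
Proof.
move=> sys Ix ex; elim: k => //= k IH.
by case/andP: (beta_step sys (orbit_mem k sys Ix) IH).
Qed.

Lemma orbit_norm_step (R : realType) (I : set R) (beta : R -> R) (s0 e x : R) (k : nat) :
  beta_system I beta s0 -> I x -> 0 < e * (x - s0) -> `|e| = 1 ->
  `|iter k beta x - iter k.+1 beta x| = e * (iter k beta x - iter k.+1 beta x).
Proof.
move=> sys Ix ex e1; rewrite -[LHS]mul1r -e1 -normrM ger0_norm//=.
have /andP[_] := beta_step sys (orbit_mem k sys Ix) (orbit_side k sys Ix ex).
lra.
Qed.

(** The distances to [s0] decrease, so the orbit has a limit; by continuity this limit is a fixed
    point, and [s0] is the only one. *)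
Lemma orbit_cvg (R : realType) (I : set R) (beta : R -> R) (s0 e x : R) :
  beta_system I beta s0 -> I x -> 0 < e * (x - s0) -> `|e| = 1 ->
  iter k beta x @[k --> \oo] --> s0.
Proof.
move=> sys Ix ex e1.
have ee : e * e = 1 by rewrite -expr2 -real_normK ?num_real// e1 expr1n.
pose z k := e * (iter k beta x - s0).
have z0 k : 0 < z k := orbit_side k sys Ix ex.
have zdec : {homo z : n m / (n <= m)%N >-> m <= n}.
  apply/nonincreasing_seqP => k; apply: ltW.
  by case/andP: (beta_step sys (orbit_mem k sys Ix) (orbit_side k sys Ix ex)).
have cz : cvgn z.
  by apply: nonincreasing_is_cvgn => //; exists 0 => _ [k _ <-]; exact: ltW.
pose l := s0 + e * limn z.
have xl : iter k beta x @[k --> \oo] --> l.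
  rewrite (_ : (fun k => iter k beta x) = fun k => s0 + e * z k).
    by apply: cvgD; [exact: cvg_cst | exact: cvgMr].
  by apply/funext => k; rewrite /z mulrA ee mul1r addrC subrK.
have lim0 : 0 <= limn z by apply: limr_ge => //; apply: nearW => k; exact: ltW.
have limx : limn z <= e * (x - s0) by exact: (nonincreasing_cvgn_ge zdec cz 0%N).
(* [I] need not be closed, but [l] lies between [s0] and [x]. *)
have Il : I l.
  have : e = 1 \/ e = -1.
    by move/eqP: e1; rewrite eqr_norml ler01 andbT => /orP[]/eqP; [left|right].
  move=> [eE|eE]; move: limx; rewrite /l eE => limx.
    by apply: (bs_interval sys (bs_mem sys) Ix); lra.
  by apply: (bs_interval sys Ix (bs_mem sys)); lra.
have bl : beta (iter k beta x) @[k --> \oo] --> beta l.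
  have /subspace_continuousP/(_ _ Il) cont := bs_continuous sys.
  (* Continuity holds only relative to [I], so the orbit has to converge along the filter of
     neighbourhoods of [l] within [I]. *)
  have orbI : iter k beta x @[k --> \oo] --> within I (nbhs l).
    move=> P /xl xlP.
    have {xlP} : \forall k \near \oo, I (iter k beta x) -> P (iter k beta x) := xlP.
    by apply: filterS => k kP; apply: kP; exact: (orbit_mem k sys Ix).
  exact: (cvg_comp _ _ orbI cont).
have bl' : beta (iter k beta x) @[k --> \oo] --> l.
  by have := xl; rewrite -(cvg_shiftS _ (nbhs l)).
have lE : beta l = l by apply: cvg_unique bl bl'.
by rewrite -(bs_unique sys Il lE).
Qed.

(** All steps have the same sign, so their lengths telescope. This is the total mass carried by one
    orbit. *)
Lemma orbit_length (R : realType) (I : set R) (beta : R -> R) (s0 e x : R) :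
  beta_system I beta s0 -> I x -> 0 < e * (x - s0) -> `|e| = 1 ->
  series (fun k => `|iter k beta x - iter k.+1 beta x|) @ \oo --> e * (x - s0).
Proof.
move=> sys Ix ex e1.
rewrite (_ : (fun k => _) = (fun k => e * (iter k beta x - iter k.+1 beta x))).
  exact/cvg_series_scale/cvg_series_diff/(orbit_cvg sys Ix ex e1).
by apply/funext => k; exact: orbit_norm_step sys Ix ex e1.
Qed.

(** * Sums along one orbit *)

(** To the left of [s0] the steps are negative; the factor [e] turns them into positive weights, so
    that sums can be compared termwise. *)
Lemma cvg_beta_term_normM (R : realType) (I : set R) (beta h : R -> R) (s0 e x : R) :
  beta_system I beta s0 -> I x -> 0 < e * (x - s0) -> `|e| = 1 ->
  cvgn (series (beta_term beta h x)) ->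
  series (fun k => `|iter k beta x - iter k.+1 beta x| * h (iter k beta x)) @ \oo
    --> e * limn (series (beta_term beta h x)).
Proof.
move=> sys Ix ex e1 ch.
rewrite (_ : (fun k => _) = (fun k => e * beta_term beta h x k)).
  exact: cvg_series_scale.
by apply/funext => k; rewrite (orbit_norm_step k sys Ix ex e1) -mulrA.
Qed.

Lemma cvg_beta_term (R : realType) (I : set R) (beta h : R -> R) (s0 e x : R) :
  beta_system I beta s0 -> I x -> 0 < e * (x - s0) -> `|e| = 1 ->
  cvgn (series (beta_term beta (fun t => `|h t|) x)) ->
  cvgn (series (beta_term beta h x)).
Proof.
move=> sys Ix ex e1 ch.
have := cvg_beta_term_normM sys Ix ex e1 ch.
move/cvgP; apply: cvg_series_dominated => k.
by rewrite /beta_term normrM.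
Qed.

Lemma cvg_beta_RS_term (R : realType) (I : set R) (beta f u : R -> R) (s0 e x L : R) :
  beta_system I beta s0 -> I x -> 0 < e * (x - s0) -> `|e| = 1 ->
  cvgn (series (beta_term beta (fun t => `|f t|) x)) ->
  (forall k, `|u (iter k beta x) - u (iter k.+1 beta x)|
     <= L * `|iter k beta x - iter k.+1 beta x|) ->
  cvgn (series (beta_RS_term beta f u x)).
Proof.
move=> sys Ix ex e1 cf uL.
have := cvg_series_scale (c := L) (cvg_beta_term_normM sys Ix ex e1 cf).
move/cvgP; apply: cvg_series_dominated => k.
by rewrite /beta_RS_term normrM mulrC mulrA ler_wpM2r.
Qed.

(** Added over both orbits, these bounds place the mean of [f] in [m, M]. *)
Lemma orbit_sum_bounds (R : realType) (I : set R) (beta f : R -> R) (s0 e x m M : R) :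
  beta_system I beta s0 -> I x -> 0 < e * (x - s0) -> `|e| = 1 ->
  cvgn (series (beta_term beta f x)) ->
  (forall k, m <= f (iter k beta x) <= M) ->
  m * (e * (x - s0)) <= e * limn (series (beta_term beta f x))
    <= M * (e * (x - s0)).
Proof.
move=> sys Ix ex e1 cf fmM.
have cF := cvg_beta_term_normM sys Ix ex e1 cf.
have cD := orbit_length sys Ix ex e1.
apply/andP; split.
  apply: (ler_cvg_series _ (cvg_series_scale (c := m) cD) cF) => k.
  by rewrite mulrC ler_wpM2l//; case/andP: (fmM k).
apply: (ler_cvg_series _ cF (cvg_series_scale (c := M) cD)) => k.
by rewrite mulrC ler_wpM2r//; case/andP: (fmM k).
Qed.

(** * Estimates by an affine majorant of |f - mu| *)

(** Since [u x - orbit_lim beta u x] is the telescoped sum of the increments of [u], the left-hand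
    side is the sum of [f - mu] against these increments, each at most [L] times a step length. *)
Lemma orbit_RS_bound (R : realType) (I : set R) (beta f u : R -> R)
    (s0 e x L mu A B : R) :
  beta_system I beta s0 -> I x -> 0 < e * (x - s0) -> `|e| = 1 ->
  cvgn (series (beta_term beta f x)) ->
  cvgn (series (beta_RS_term beta f u x)) ->
  cvgn (fun n => u (iter n beta x)) ->
  (forall k, `|u (iter k beta x) - u (iter k.+1 beta x)|
     <= L * `|iter k beta x - iter k.+1 beta x|) ->
  (forall k, `|f (iter k beta x) - mu| <= A + B * f (iter k beta x)) ->
  `|limn (series (beta_RS_term beta f u x)) - mu * (u x - orbit_lim beta u x)|
    <= L * (A * (e * (x - s0)) + B * (e * limn (series (beta_term beta f x)))).
Proof.
move=> sys Ix ex e1 cf cfu cu uL fAB.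
have cF := cvg_series_scale (c := B) (cvg_beta_term_normM sys Ix ex e1 cf).
have cD := cvg_series_scale (c := A) (orbit_length sys Ix ex e1).
have cV := cvg_series_scale (c := - mu) (cvg_series_diff cu).
have := cvg_series_scale (c := L) (cvg_series_add cD cF).
have := cvg_series_add cfu cV.
rewrite mulNr; apply: ler_norm_cvg_series => k.
rewrite /beta_RS_term mulNr -mulrBl normrM [leRHS](_ : _ =
  (A + B * f (iter k beta x)) * (L * `|iter k beta x - iter k.+1 beta x|)).
  exact: ler_pM.
ring.
Qed.

(* The right-hand side is the chord over [m, M] of the convex function
   |p - mu|; it is 0 when m = M, since x / 0 = 0. *)
Lemma chord_bound (R : realType) (m M mu p : R) :
  m <= mu <= M -> m <= p <= M ->
  `|p - mu| <= (M * (mu - m) - m * (M - mu)) / (M - m)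
               + (M + m - 2 * mu) / (M - m) * p.
Proof.
move=> /andP[m1 m2] /andP[p1 p2].
have [Mm|mM] := leP M m.
  have -> : M = m by lra.
  have -> : p = m by lra.
  have -> : mu = m by lra.
  by rewrite !subrr invr0 !mulr0 mul0r addr0 normr0.
rewrite mulrAC -mulrDl ler_pdivlMr ?subr_gt0//.
(* With the denominator cleared, the gap is 2 (M - mu) (p - m) if p <= mu, and 2 (mu - m) (M - p)
   otherwise. *)
by have [pm|pm] := leP p mu; [rewrite ler0_norm|rewrite gtr0_norm]; nra.
Qed.

(** For m < M the chord takes the value 2 (M - mu) (mu - m) / (M - m) at [mu], and (M - m)^2 - 4 (M
    - mu) (mu - m) is the square of M + m - 2 mu. *)
Lemma chord_mean_le (R : realType) (m M mu : R) : m <= mu <= M ->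
  (M * (mu - m) - m * (M - mu)) / (M - m) + (M + m - 2 * mu) / (M - m) * mu
    <= 2^-1 * (M - m).
Proof.
move=> /andP[m1 m2].
have [Mm|mM] := leP M m.
  have -> : M = m by lra.
  by rewrite subrr invr0 !mulr0 mul0r addr0.
rewrite mulrAC -mulrDl ler_pdivrMr ?subr_gt0//.
by have := sqr_ge0 (M + m - 2 * mu); rewrite expr2; lra.
Qed.

(** * The inequality with constant 1/2 *)

Lemma beta_RS_integral_bound (R : realType) (I : set R) (beta : R -> R)
    (s0 a b : R) (f u : R -> R) (m M L : R) :
  admissible I beta s0 a b f u m M L ->
  [/\ beta_integrable beta f a b,
      beta_RS_integrable beta f u a b &
      `| beta_RS_integral beta f u a b -
         (u b - u a - (orbit_lim beta u b - orbit_lim beta u a)) / (b - a) *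
           beta_integral beta f a b |
        <= 2^-1 * L * (M - m) * (b - a)].
Proof.
case=> sys Ia Ib as0 s0b [cfa cfb] fmM uL cua cub.
have ea : 0 < -1 * (a - s0) by lra.
have eb : 0 < 1 * (b - s0) by lra.
have na : `|-1| = 1 :> R by rewrite normrN normr1.
have nb : `|1| = 1 :> R by rewrite normr1.
have ka k : beta_interval beta s0 a b (iter k beta a) by left; left; exists k.
have kb k : beta_interval beta s0 a b (iter k beta b) by left; right; exists k.
have uLa k := uL _ (ka k); have uLb k := uL _ (kb k).
have Fa := cvg_beta_term sys Ia ea na cfa.
have Fb := cvg_beta_term sys Ib eb nb cfb.
have Wa := cvg_beta_RS_term sys Ia ea na cfa uLa.
have Wb := cvg_beta_RS_term sys Ib eb nb cfb uLb.
split; [by split | by split |].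
(* The Lipschitz condition at [b] forces this, because [beta b] differs from [b]. *)
have L0 : 0 <= L.
  have := le_trans (normr_ge0 _) (uLb 0%N); rewrite pmulr_lge0// normr_gt0/=.
  have /andP[_] := beta_step sys Ib eb; rewrite !mul1r => bb.
  by rewrite subr_eq0; apply: contraTneq bb => <-; rewrite ltxx.
have := orbit_sum_bounds sys Ia ea na Fa (fun k => fmM _ (ka k)).
have := orbit_sum_bounds sys Ib eb nb Fb (fun k => fmM _ (kb k)).
pose mu := beta_integral beta f a b / (b - a).
have ab : 0 < b - a by lra.
have muE : beta_integral beta f a b = mu * (b - a) by rewrite divfK ?gt_eqF.
move=> /andP[b1 b2] /andP[a1 a2].
have mu_mM : m <= mu <= M.
  by rewrite /mu ler_pdivlMr// ler_pdivrMr// /beta_integral; apply/andP; split; lra.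
have chord k := chord_bound mu_mM k.
have mean := chord_mean_le mu_mM.
have Ba := orbit_RS_bound sys Ia ea na Fa Wa cua uLa (fun k => chord _ (fmM _ (ka k))).
have Bb := orbit_RS_bound sys Ib eb nb Fb Wb cub uLb (fun k => chord _ (fmM _ (kb k))).
move: mean Ba Bb.
set A := (_ - m * (M - mu)) / _; set B := (M + m - _) / _ => mean Ba Bb.
rewrite muE [X in `|_ - X|](_ : _ =
  mu * (u b - orbit_lim beta u b) - mu * (u a - orbit_lim beta u a)); last first.
  by field; rewrite gt_eqF.
rewrite [X in `|X|](_ : _ =
  (limn (series (beta_RS_term beta f u b)) - mu * (u b - orbit_lim beta u b)) -
  (limn (series (beta_RS_term beta f u a)) - mu * (u a - orbit_lim beta u a)));
  last by rewrite /beta_RS_integral; ring.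
apply: le_trans (ler_normB _ _) _; apply: le_trans (lerD Bb Ba) _.
(* The masses of the two orbits add up to [b - a] and the sums of [f] to [mu * (b - a)], so the
   chord integrates to [b - a] times its value at [mu]. *)
rewrite -mulrDr [leLHS](_ : _ = L * (b - a) * (A + B * mu)); last first.
  transitivity (L * (A * (b - a) + B * beta_integral beta f a b)).
    by rewrite /beta_integral; ring.
  by rewrite muE; ring.
rewrite [leRHS](_ : _ = L * (b - a) * (2^-1 * (M - m))); last by ring.
by rewrite ler_wpM2l// mulr_ge0// ltW.
Qed.

(** * Sharpness of the constant, with [beta] halving the real line *)

Lemma half_beta_system (R : realType) :
  beta_system [set: R] (fun x => x / 2) 0.
Proof.
split => //=.
- by move=> x y _ _ xy; rewrite ltr_pM2r.
- by apply: continuous_subspaceT => x; apply: cvgMl; exact: cvg_id.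
- by rewrite mul0r.
- by move=> t _ tt; lra.
- by move=> t _; have := sqr_ge0 t; rewrite expr2; nra.
- move=> t _ t0; apply/eqP; rewrite -(@sqrf_eq0 R); apply/eqP.
  by rewrite expr2; lra.
Qed.

Lemma sgr_half_orbit (R : realType) (x : R) (k : nat) :
  Num.sg (iter k (fun y => y / 2) x) = Num.sg x.
Proof.
by elim: k => //= k IH; rewrite sgrM IH (gtr0_sg (x := 2^-1)) ?mulr1 ?invr_gt0.
Qed.

Theorem theorem4p5 (R : realType) :
  (forall (I : set R) (beta : R -> R) (s0 a b : R) (f u : R -> R) (m M L : R),
     admissible I beta s0 a b f u m M L ->
     [/\ beta_integrable beta f a b,
         beta_RS_integrable beta f u a b &
         `| beta_RS_integral beta f u a b -
            (u b - u a - (orbit_lim beta u b - orbit_lim beta u a)) / (b - a) *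
              beta_integral beta f a b |
           <= 2^-1 * L * (M - m) * (b - a)]) /\
  ~ (exists c : R, c < 2^-1 /\
       forall (I : set R) (beta : R -> R) (s0 a b : R) (f u : R -> R)
              (m M L : R),
         admissible I beta s0 a b f u m M L ->
         `| beta_RS_integral beta f u a b -
            (u b - u a - (orbit_lim beta u b - orbit_lim beta u a)) / (b - a) *
              beta_integral beta f a b |
           <= c * L * (M - m) * (b - a)).
Proof.
split; first exact: beta_RS_integral_bound.
move=> [c [c2 cP]].
(* Equality case: a = -1, b = 1, f = sg and u = |.|; the mean of f is 0. *)
pose beta := fun x : R => x / 2.
have sys : beta_system setT beta 0 := half_beta_system R.
have side (e : R) : `|e| = 1 -> 0 < e * (e - 0).
  by move=> e1; rewrite subr0 -expr2 -real_normK ?num_real// e1 expr1n.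
have orb (e : R) : `|e| = 1 -> iter k beta e @[k --> \oo] --> (0 : R).
  by move=> e1; exact: (orbit_cvg sys I (side e e1) e1).
have orbn (e : R) : `|e| = 1 -> `|iter n beta e| @[n --> \oo] --> (0 : R).
  by move=> e1; rewrite -(@normr0 _ R); apply: cvg_norm; exact: orb.
(* The sign is constant along an orbit, so [Num.sg] times a step is a step of the absolute value.
   Both endpoints give 1, and the integral of [f] vanishes. *)
have int (e : R) : `|e| = 1 ->
    limn (series (beta_term beta Num.sg e)) = 1.
  move=> e1; apply: cvg_lim => //.
  rewrite (_ : beta_term _ _ _ =
      (fun k => `|iter k beta e| - `|iter k.+1 beta e|)).
    have := cvg_series_diff (orbn e e1).
    by rewrite /= e1 subr0.
  apply/funext => k; rewrite /beta_term !sgr_half_orbit.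
  by rewrite mulrBl !(normrEsg (iter _ _ _)) !sgr_half_orbit mulrC [X in _ - X]mulrC.
(* Conversely, [Num.sg] times a step of the absolute value is a step of the orbit. The Stieltjes
   integral is therefore 1 - (-1) = 2. *)
have RS (e : R) : `|e| = 1 ->
    limn (series (beta_RS_term beta Num.sg Num.norm e)) = e.
  move=> e1; apply: cvg_lim => //.
  rewrite (_ : beta_RS_term _ _ _ _ =
      (fun k => iter k beta e - iter k.+1 beta e)).
    by have := cvg_series_diff (orb e e1); rewrite /= subr0.
  have sg2 : Num.sg e * Num.sg e = 1.
    by rewrite -expr2 sqr_sg -normr_eq0 e1 oner_eq0.
  apply/funext => k; rewrite /beta_RS_term !(normrEsg (iter _ _ _)) !sgr_half_orbit.
  by rewrite mulrBr !mulrA sg2 !mul1r.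
have n1 : `|1| = 1 :> R by rewrite normr1.
have nN1 : `|-1| = 1 :> R by rewrite normrN normr1.
have abs (e : R) : `|e| = 1 ->
    cvgn (series (beta_term beta (fun t => `|Num.sg t|) e)).
  move=> e1; rewrite (_ : beta_term _ _ _ =
      (fun k => iter k beta e - iter k.+1 beta e)).
    exact/cvgP/cvg_series_diff/orb.
  apply/funext => k; rewrite /beta_term !sgr_half_orbit normr_sg.
  by rewrite -normr_eq0 e1 oner_eq0 mulr1.
have adm : admissible setT beta 0 (-1) 1 Num.sg Num.norm (-1) 1 1.
  split => //.
  - by split; exact: abs.
  - by move=> x _; rewrite -ler_norml normr_sg lern1 leq_b1.
  - by move=> x _; rewrite mul1r; exact: ler_dist_dist.
  - exact/cvgP/orbn.
  - exact/cvgP/orbn.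
(* This instance reads 2 <= 4 c, against c < 1/2. *)
have := cP _ _ _ _ _ _ _ _ _ _ adm.
rewrite /beta_RS_integral /beta_integral !RS// !int// subrr mulr0 subr0.
by rewrite ger0_norm; lra.
Qed.
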